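(* Let $1\le p\le r<q\le\infty$ and $a\in L^r(\Omega)$. The mapping $m:L^q(\Omega)\to L^p(\Omega)$, $u\mapsto\max(a,u)$, is semi-smooth with Newton derivative (acting by pointwise multiplication) given by $h(u)\in L^s(\Omega)$, $$h(u)(x)=\begin{cases}1&\text{if }u(x)>a(x),\\0&\text{if }u(x)\le a(x),\end{cases}$$ where $s$ is chosen such that $\frac1p=\frac1s+\frac1q$.
   Context: $\Omega\subset\mathbb{R}^n$, $n\in\{1,2,3\}$, is a bounded Lipschitz domain; $\max$ is understood pointwise a.e. For Banach spaces $X,W$, a mapping $G:X\to W$ is called semi-smooth (Newton differentiable) if there is a mapping $D_NG:X\to\mathcal{L}(X,W)$ (values are bounded linear operators) such that for every $u\in X$, $$\|G(u+v)-G(u)-D_NG(u+v)v\|_W=o(\|v\|_X)\quad\text{as }\|v\|_X\to0.$$ $D_NG$ is called a Newton derivative of $G$. Here $D_Nm(u)v=h(u)\,v$. *)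

(* Defs.v *)
From HB Require Import structures.
From mathcomp Require Import all_boot all_order all_algebra.
From mathcomp Require Import all_classical all_reals all_analysis measurable_realfun ess_sup_inf.

Set Implicit Arguments.
Unset Strict Implicit.
Unset Printing Implicit Defensive.

Import Order.TTheory GRing.Theory Num.Theory.
Import numFieldNormedType.Exports.

Local Open Scope classical_set_scope.
Local Open Scope ring_scope.

(* The type LspaceType of L^p classes comes without algebraic structure or norm;
   it is made a normedModType here. *)
Section Lspace_normed.
Context d (T : measurableType d) (R : realType).
Variables (mu : {measure set T -> \bar R}) (p : \bar R) (p1 : (1 <= p)%E).

Local Notation L := (LspaceType mu p1).

Lemma Lnorm_ae (f g : T -> R) : measurable_fun setT f -> measurable_fun setT g ->
  f = g %[ae mu] -> 'N[mu]_p[EFin \o f]%E = 'N[mu]_p[EFin \o g]%E.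
Proof.
have mpow (h : T -> R) r : measurable_fun setT h ->
    measurable_fun [set: T] ((fun x => `|(EFin \o h) x| `^ r) : T -> \bar R)%E.
  move=> mh; apply: (measurableT_comp (measurable_poweR _)).
  by apply: measurableT_comp => //; exact/measurable_EFinP.
move=> mf mg fg; rewrite unlock /Lnorm; case: p p1 => [r r1|_|//].
- congr (_ `^ _)%E.
  apply: ae_eq_integral; [exact: measurableT|exact: mpow|exact: mpow|].
  by apply: filterS fg => x /= fg xT; rewrite fg.
- case: ifPn => // _; apply: eq_ess_sup.
  by apply: filterS fg => x /= ->.
Qed.

Lemma Lspace_measurable (u : L) : measurable_fun setT (u : T -> R).
Proof.
exact: (@measurable_funPT _ _ _ _
  (repr (u : {mfun_ mu, T >-> measurableTypeR R}))).
Qed.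

Lemma Lspace_Lfun (u : L) : (u : T -> R) \in Lfun mu p.
Proof.
apply/andP; split; rewrite inE /=; first exact: Lspace_measurable.
exact: Lebesgue_finite.
Qed.

Lemma Lspace_eqP (u v : L) : u = v <-> (u : T -> R) = v %[ae mu].
Proof.
split=> [->|uv]; first exact: aeW.
have : u = v :> {mfun_ mu, T >-> measurableTypeR R}.
  rewrite -[LHS]reprK -[RHS]reprK; apply/eqP; rewrite eqmodE.
  exact/asboolP.
case: u v {uv} => [u [[hu]]] [v [[hv]]] /= uv.
by subst v; rewrite (Prop_irrelevance hu hv).
Qed.

Section mk.
Variables (f : T -> R) (fL : f \in Lfun mu p).

Let mf : @measurable_fun _ _ T (measurableTypeR R) setT f.
Proof. by have := fL; rewrite inE => /andP[]; rewrite inE. Qed.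

Let f' : {mfun T >-> measurableTypeR R} :=
  HB.pack f (@isMeasurableFun.Build _ _ T (measurableTypeR R) f mf).
Let cf : {mfun_ mu, T >-> measurableTypeR R} := \pi%qT f'.

Let cf_ae : (cf : T -> R) = f %[ae mu].
Proof.
have /eqP : \pi%qT (repr cf) = \pi%qT f' :> {mfun_ mu, T >-> measurableTypeR R}.
  by rewrite reprK.
by rewrite eqmodE => /asboolP.
Qed.

Let cf_fin : finite_norm mu p cf.
Proof.
have /andP[_] := fL; rewrite inE /= /finite_norm => ffin.
rewrite (Lnorm_ae _ _ cf_ae) //.
exact: (@measurable_funPT _ _ _ _ (repr cf)).
Qed.

HB.instance Definition _ := isFinLebesgue.Build _ _ _ _ _ p1 cf cf_fin.

Definition toLspace : L := cf.

Lemma toLspaceE : (toLspace : T -> R) = f %[ae mu].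
Proof. exact: cf_ae. Qed.

End mk.

Definition Lspace_add (u v : L) : L :=
  toLspace ((Lfun_addr_closed mu p1).2 _ _ (Lspace_Lfun u) (Lspace_Lfun v)).
Definition Lspace_opp (u : L) : L :=
  toLspace (Lfun_oppr_closed (Lspace_Lfun u)).
Definition Lspace_zero : L := toLspace (Lfun_addr_closed mu p1).1.

Lemma Lfun_scale_closed a (u : L) : a *: (u : T -> R) \in Lfun mu p.
Proof.
have [L0 LZ] := Lfun_submod_closed mu p1.
by have := LZ a _ _ (Lspace_Lfun u) L0; rewrite addr0.
Qed.

Definition Lspace_scale (a : R) (u : L) : L := toLspace (Lfun_scale_closed a u).

Lemma Lspace_addE u v :
  (Lspace_add u v : T -> R) = (fun x => u x + v x) %[ae mu].
Proof. exact: toLspaceE. Qed.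
Lemma Lspace_oppE u : (Lspace_opp u : T -> R) = (fun x => - u x) %[ae mu].
Proof. exact: toLspaceE. Qed.
Lemma Lspace_zeroE : (Lspace_zero : T -> R) = cst 0 %[ae mu].
Proof. exact: toLspaceE. Qed.
Lemma Lspace_scaleE a u :
  (Lspace_scale a u : T -> R) = (fun x => a * u x) %[ae mu].
Proof. exact: toLspaceE. Qed.

Lemma Lspace_addA : associative Lspace_add.
Proof.
move=> u v w; apply/Lspace_eqP.
have h1 := Lspace_addE u (Lspace_add v w); have h2 := Lspace_addE v w.
have h3 := Lspace_addE (Lspace_add u v) w; have h4 := Lspace_addE u v.
by apply: filterS3 (filterI h1 h2) h3 h4 => x [h1' h2'] h3' h4' I; rewrite h1'// h2'// h3'// h4'// addrA.
Qed.

Lemma Lspace_addC : commutative Lspace_add.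
Proof.
move=> u v; apply/Lspace_eqP.
have h1 := Lspace_addE u v; have h2 := Lspace_addE v u.
by apply: filterS2 h1 h2 => x h1 h2 I; rewrite h1// h2// addrC.
Qed.

Lemma Lspace_add0 : left_id Lspace_zero Lspace_add.
Proof.
move=> u; apply/Lspace_eqP.
have h1 := Lspace_addE Lspace_zero u; have h2 := Lspace_zeroE.
by apply: filterS2 h1 h2 => x h1 h2 I; rewrite h1// h2// add0r.
Qed.

Lemma Lspace_addN : left_inverse Lspace_zero Lspace_opp Lspace_add.
Proof.
move=> u; apply/Lspace_eqP.
have h1 := Lspace_addE (Lspace_opp u) u; have h2 := Lspace_zeroE.
have h3 := Lspace_oppE u.
by apply: filterS3 h1 h2 h3 => x h1 h2 h3 I; rewrite h1// h2// h3// addNr.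
Qed.

HB.instance Definition _ := gen_eqMixin L.
HB.instance Definition _ := gen_choiceMixin L.
HB.instance Definition _ := GRing.isZmodule.Build L
  Lspace_addA Lspace_addC Lspace_add0 Lspace_addN.

Lemma Lspace_scaleA a b u :
  Lspace_scale a (Lspace_scale b u) = Lspace_scale (a * b) u.
Proof.
apply/Lspace_eqP.
have h1 := Lspace_scaleE a (Lspace_scale b u); have h2 := Lspace_scaleE b u.
have h3 := Lspace_scaleE (a * b) u.
by apply: filterS3 h1 h2 h3 => x h1 h2 h3 I; rewrite h1// h2// h3// mulrA.
Qed.

Lemma Lspace_scale1 : left_id 1 Lspace_scale.
Proof.
move=> u; apply/Lspace_eqP; have h1 := Lspace_scaleE 1 u.
by apply: filterS h1 => x h1 I; rewrite h1// mul1r.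
Qed.

Lemma Lspace_scaleDr : right_distributive Lspace_scale +%R.
Proof.
move=> a u v; apply/Lspace_eqP.
have h1 := Lspace_scaleE a (u + v); have h2 := Lspace_addE u v.
have h3 := Lspace_addE (Lspace_scale a u) (Lspace_scale a v).
have h4 := Lspace_scaleE a u; have h5 := Lspace_scaleE a v.
apply: filterS2 (filterI h4 h5) (filterI (filterI h1 h2) h3).
move=> x [h4' h5'] [[h1' h2'] h3'] I.
by rewrite h1'// h2'// h3'// h4'// h5'// mulrDr.
Qed.

Lemma Lspace_scaleDl u : {morph Lspace_scale^~ u : a b / a + b}.
Proof.
move=> a b; apply/Lspace_eqP.
have h1 := Lspace_scaleE (a + b) u; have h2 := Lspace_scaleE a u.
have h3 := Lspace_scaleE b u.
have h4 := Lspace_addE (Lspace_scale a u) (Lspace_scale b u).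
apply: filterS3 (filterI h1 h2) h3 h4 => x [h1' h2'] h3' h4' I.
by rewrite h1'// h4'// h2'// h3'// mulrDl.
Qed.

HB.instance Definition _ := GRing.Zmodule_isLmodule.Build R L
  Lspace_scaleA Lspace_scale1 Lspace_scaleDr Lspace_scaleDl.

Definition Lspace_norm (u : L) : R := fine 'N[mu]_p[EFin \o u]%E.

Lemma Lspace_normE (u : L) : (Lspace_norm u)%:E = 'N[mu]_p[EFin \o u]%E.
Proof. exact: (@finite_norm_fine _ _ _ mu p p1 (Lfun_Sub p1 (Lspace_Lfun u))). Qed.

Lemma Lspace_normD u v : Lspace_norm (u + v) <= Lspace_norm u + Lspace_norm v.
Proof.
rewrite -lee_fin EFinD !Lspace_normE (Lnorm_ae _ _ (Lspace_addE u v)).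
- exact: (@eminkowski _ _ _ mu u v p (Lspace_measurable u) (Lspace_measurable v) p1).
- exact: Lspace_measurable.
- by apply: measurable_funD; exact: Lspace_measurable.
Qed.

Lemma Lspace_normZ a u : Lspace_norm (a *: u) = `|a| * Lspace_norm u.
Proof.
apply: EFin_inj; rewrite EFinM !Lspace_normE (Lnorm_ae _ _ (Lspace_scaleE a u)).
- exact: (@LnormZ _ _ _ mu p p1 (Lfun_Sub p1 (Lspace_Lfun u)) a).
- exact: Lspace_measurable.
- by apply: measurable_funM => //; exact: Lspace_measurable.
Qed.

Lemma Lspace_norm0_eq0 u : Lspace_norm u = 0 -> u = 0.
Proof.
move=> u0; apply/Lspace_eqP.
have h1 := @fine_Lnormr_eq0 _ _ _ mu p p1 (Lfun_Sub p1 (Lspace_Lfun u)) u0.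
have h2 := Lspace_zeroE.
by apply: filterS2 h1 h2 => x h1 h2 I; exact: etrans (h1 I) (esym (h2 I)).
Qed.

HB.instance Definition _ := @Lmodule_isNormed.Build R L Lspace_norm
  Lspace_normD Lspace_normZ Lspace_norm0_eq0.

End Lspace_normed.

Definition borelRn (R : realType) (n : nat) :=
  g_sigma_algebraType (@open 'rV[R]_n).

Section lebesgue_Rn.
Context (R : realType).

Lemma open_borelRn n (A : set 'rV[R]_n) :
  open A -> measurable (A : set (borelRn R n)).
Proof. exact: sub_sigma_algebra. Qed.

Lemma measurable_coord n (i : 'I_n) :
  measurable_fun [set: borelRn R n] (fun x : 'rV[R]_n => x 0 i : measurableTypeR R).
Proof.
apply: (@measurability _ _ _ (measurableTypeR R) _ _ _ (RGenOpens.measurableE R)).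
move=> _ [_ [a [b ->]] <-]; rewrite setTI; apply: open_borelRn.
apply: (@open_comp _ _ (fun x : 'rV[R]_n => x 0 i)) => [x _|].
  exact: coord_continuous.
exact: interval_open.
Qed.

Lemma measurable_fun_borelRn d (T : measurableType d) n (f : T -> borelRn R n) :
  (forall i, measurable_fun setT (fun x => (f x : 'rV[R]_n) 0 i : measurableTypeR R)) ->
  measurable_fun setT f.
Proof.
move=> mf; apply: (@measurability _ _ _ (borelRn R n) _ _ (@open 'rV[R]_n)) => //.
move=> _ [A oA <-]; rewrite setTI.
pose B (q : 'rV[rat]_n * nat) : set 'rV[R]_n :=
  [set y | forall i, `|ratr (q.1 0 i) - y 0 i| < q.2.+1%:R^-1].
have mB q : measurable (f @^-1` B q).
  have -> : f @^-1` B q = \bigcap_(i in [set: 'I_n])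
      ((fun x => (f x : 'rV[R]_n) 0 i) @^-1` ball (ratr (q.1 0 i) : R) q.2.+1%:R^-1).
    by apply/seteqP; split => x /= h i; [move=> _; exact: h|exact: h].
  apply: fin_bigcap_measurable; first by apply: finite_finset.
  move=> i _; rewrite -[X in measurable X]setTI; apply: mf => //.
  by apply: open_measurable; apply: ball_open; rewrite invr_gt0.
have -> : f @^-1` A =
    \bigcup_(q in [set: 'rV[rat]_n * nat])
      (if `[< B q `<=` A >] then f @^-1` B q else set0).
  apply/seteqP; split => x /=; last first.
    by move=> [q _]; case: asboolP => // BA Bfx; exact: BA.
  move=> Afx; have /nbhs_ballP[e /= e0 eA] : nbhs (f x : 'rV[R]_n) A.
    by apply: open_nbhs_nbhs; split.
  have e20 : 0 < e / 2 by rewrite divr_gt0.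
  have [k /andP[_ ke]] : exists k, true && (k.+1%:R^-1 < e / 2).
    have [k _ /(_ _ (leqnn k)) ke] := near_infty_natSinv_lt (PosNum e20).
    by exists k.
  have dq i : {q : rat | `|ratr q - (f x : 'rV[R]_n) 0 i| < k.+1%:R^-1}.
    apply: cid; have k0 : (f x : 'rV[R]_n) 0 i - k.+1%:R^-1 <
        (f x : 'rV[R]_n) 0 i + k.+1%:R^-1.
      by rewrite ltrD2l gtrN// invr_gt0.
    have [q] := rat_in_itvoo k0; rewrite in_itv/= => /andP[q1 q2].
    by exists q; rewrite ltr_distl q1 q2.
  exists (\row_i sval (dq i), k) => //; case: asboolP => [_ i /=|].
    by rewrite mxE; exact: (svalP (dq i)).
  case=> y By; apply: eA; split => // i j; rewrite ord1 /ball/=.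
  have := By j; rewrite /= mxE => h1; have h2 := svalP (dq j).
  rewrite (le_lt_trans (ler_distD (ratr (sval (dq j))) _ _))//.
  by rewrite (splitr e) ltrD// ?(lt_trans _ ke)// distrC.
apply: countable_bigcupT_measurable => [|q]; first exact: countableP.
by case: ifP.
Qed.


Definition consRn n (z : measurableTypeR R * borelRn R n) : borelRn R n.+1 :=
  row_mx (z.1%:M : 'rV[R]_1) z.2 : 'rV[R]_(1 + n).

Lemma consRn0 n z : (consRn z : 'rV[R]_n.+1) 0 0 = z.1.
Proof.
have := row_mxEl (z.1%:M : 'rV[R]_1) (z.2 : 'rV[R]_n) 0 0.
rewrite [in RHS]mxE eqxx mulr1n => <-; congr ((consRn z : 'rV[R]_n.+1) 0 _).
exact/val_inj.
Qed.

Lemma consRnS n z (i : 'I_n) :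
  (consRn z : 'rV[R]_n.+1) 0 (lift 0 i) = (z.2 : 'rV[R]_n) 0 i.
Proof.
rewrite -[RHS](row_mxEr (z.1%:M : 'rV[R]_1) (z.2 : 'rV[R]_n) 0 i).
by congr ((consRn z : 'rV[R]_n.+1) 0 _); exact/val_inj.
Qed.

Lemma measurable_consRn n : measurable_fun setT (@consRn n).
Proof.
apply: measurable_fun_borelRn => i.
have [->|[j ->]] : i = 0 \/ exists j, i = lift 0 j.
- by case: (unliftP 0 i) => [j ->|->]; [right; exists j|left].
- under eq_fun do rewrite consRn0.
  exact: measurable_fst.
- under eq_fun do rewrite consRnS.
  exact: (measurableT_comp (measurable_coord j) measurable_snd).
Qed.

Section lebesgue_cons.
Variables (n : nat) (m : {sigma_finite_measure set (borelRn R n) -> \bar R}).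

Definition lebesgue_cons : set (borelRn R n.+1) -> \bar R :=
  pushforward (@lebesgue_measure R \x m)%E (@consRn n).

Let lebesgue_cons0 : lebesgue_cons set0 = 0%E.
Proof. by rewrite /lebesgue_cons /pushforward preimage_set0 measure0. Qed.

Let lebesgue_cons_ge0 A : (0 <= lebesgue_cons A)%E.
Proof. by rewrite /lebesgue_cons /pushforward; apply: measure_ge0. Qed.

Let lebesgue_cons_sigma_additive : semi_sigma_additive lebesgue_cons.
Proof.
move=> F mF tF mUF; rewrite /lebesgue_cons /pushforward preimage_bigcup.
have mcF A : measurable A -> measurable (@consRn n @^-1` A).
  by move=> mA; rewrite -[X in measurable X]setTI; exact: measurable_consRn.
apply: measure_semi_sigma_additive => [k||].
- exact: mcF.
- apply/trivIsetP => /= i j _ _ ij; rewrite -preimage_setI.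
  by move/trivIsetP : tF => /(_ _ _ _ _ ij) ->//; rewrite preimage_set0.
- by rewrite -preimage_bigcup; exact: mcF.
Qed.

HB.instance Definition _ := isMeasure.Build _ _ _ lebesgue_cons
  lebesgue_cons0 lebesgue_cons_ge0 lebesgue_cons_sigma_additive.

Let unconsRn (x : borelRn R n.+1) : measurableTypeR R * borelRn R n :=
  ((x : 'rV[R]_n.+1) 0 0, \row_i (x : 'rV[R]_n.+1) 0 (lift 0 i)).

Let consRnK : cancel (@consRn n) unconsRn.
Proof.
move=> [a v]; rewrite /unconsRn consRn0; congr pair.
by apply/rowP => i; rewrite mxE consRnS.
Qed.

Let measurable_unconsRn : measurable_fun setT unconsRn.
Proof.
apply/measurable_fun_pairP; split; first exact: measurable_coord.
apply: measurable_fun_borelRn => i; under eq_fun do rewrite /= mxE.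
exact: measurable_coord.
Qed.

Let lebesgue_cons_sigma_finite : sigma_finite setT lebesgue_cons.
Proof.
suff : sigma_finite setT (@lebesgue_measure R \x m)%E.
  move=> [F UF mF].
  exists (fun k => unconsRn @^-1` F k); first by rewrite -preimage_bigcup -UF.
  move=> k; split.
    rewrite -[X in measurable X]setTI; apply: measurable_unconsRn => //.
    exact: (mF k).1.
  rewrite /lebesgue_cons /pushforward -comp_preimage.
  rewrite (_ : _ \o _ = id); last exact/funext/consRnK.
  by rewrite preimage_id; exact: (mF k).2.
have /sigma_finiteP[F [TF ndF Foo]] := sigma_finiteT (@lebesgue_measure R).
have /sigma_finiteP[G [TG ndG Goo]] := sigma_finiteT m.
exists (fun k => F k `*` G k).
  rewrite -setXTT TF TG predeqE => -[x y]; split.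
    move=> [/= [k _ Fkx] [l _ Gly]]; exists (maxn k l) => //; split.
    - by move: x Fkx; exact/subsetPset/ndF/leq_maxl.
    - by move: y Gly; exact/subsetPset/ndG/leq_maxr.
  by move=> [k _ []/= ? ?]; split; exists k.
move=> k; have [? ?] := Foo k; have [? ?] := Goo k.
split; first exact: measurableX.
by rewrite product_measure1E// lte_mul_pinfty// ge0_fin_numE.
Qed.

HB.instance Definition _ := @Measure_isSigmaFinite.Build _ _ _ lebesgue_cons
  lebesgue_cons_sigma_finite.

End lebesgue_cons.

Fixpoint lebesgue_Rn n : {sigma_finite_measure set (borelRn R n) -> \bar R} :=
  match n with
  | 0%N => @dirac _ (borelRn R 0) (0 : 'rV[R]_0) R
  | n'.+1 => lebesgue_cons (lebesgue_Rn n')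
  end.

Lemma lebesgue_Rn_box n (a b : 'rV[R]_n) : (forall i, a 0 i <= b 0 i) ->
  lebesgue_Rn n [set x : 'rV[R]_n | forall i, a 0 i <= x 0 i <= b 0 i] =
  (\prod_(i < n) (b 0 i - a 0 i))%:E.
Proof.
elim: n a b => [|n IH] a b ab /=.
  by rewrite big_ord0 diracE mem_set// => -[].
rewrite /lebesgue_cons /pushforward.
rewrite (_ : _ @^-1` _ = `[a 0 0, b 0 0]%classic `*`
  [set x : 'rV[R]_n | forall i,
     (\row_i a 0 (lift 0 i)) 0 i <= x 0 i <= (\row_i b 0 (lift 0 i)) 0 i]).
  rewrite product_measure1E//; last first.
    rewrite (_ : [set x | _] = \bigcap_(i in [set: 'I_n])
      ((fun x : borelRn R n => (x : 'rV[R]_n) 0 i) @^-1`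
         `[a 0 (lift 0 i), b 0 (lift 0 i)])).
      apply: fin_bigcap_measurable; first by apply: finite_finset.
      move=> i _; rewrite -[X in measurable X]setTI.
      exact: measurable_coord.
    apply/seteqP; split => x /= h i.
      by move=> _; have := h i; rewrite !mxE /= in_itv.
    by have := h i Logic.I; rewrite /= in_itv !mxE.
  rewrite IH => [|i]; last by rewrite !mxE.
  have -> : measure_function.Measure.sort (@lebesgue_measure R) `[a 0 0, b 0 0]%classic
      = (b 0 0 - a 0 0)%:E :> \bar R.
    etransitivity; first exact: (lebesgue_measure_itv `[a 0 0, b 0 0]).
    rewrite /= lte_fin; have := ab 0; rewrite le_eqVlt => /predU1P[->|->] //.
    by rewrite ltxx subrr.
  rewrite -EFinM big_ord_recl; congr (_ * _)%:E.
  by apply: eq_bigr => i _; rewrite !mxE.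
apply/seteqP; split => [[x v] /= h|[x v] /= [hx hv] i].
  split; first by have := h 0; rewrite consRn0 /= in_itv.
  by move=> i; have := h (lift 0 i); rewrite consRnS !mxE.
case: (unliftP 0 i) => [j ->|->].
  by rewrite consRnS; have := hv j; rewrite !mxE.
by rewrite consRn0; move: hx; rewrite /= in_itv.
Qed.

End lebesgue_Rn.

(* L^p(Omega) is LspaceType (lebesgue_on _): its elements are represented by
   functions on the whole of R^n, identified when they agree almost everywhere
   on Omega. *)
Definition lebesgue_on (R : realType) (n : nat) (Omega : set 'rV[R]_n)
    (oOmega : open Omega) : {measure set (borelRn R n) -> \bar R} :=
  mrestr (lebesgue_Rn R n) (open_borelRn oOmega).

(* Near each boundary point and up to an orthogonal change of coordinates, the
   set is the strict epigraph of a Lipschitz function of all coordinates but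
   the j-th one.  The translation to the boundary point is absorbed in the
   function; for n = 1 the function is a constant. *)
Definition lipschitz_boundary (R : realType) (n : nat) (Omega : set 'rV[R]_n) :=
  forall x0, (closure Omega `\` interior Omega) x0 ->
  exists (U : set 'rV[R]_n) (Q : 'M[R]_n) (j : 'I_n) (g : 'rV[R]_n.-1 -> R),
    [/\ nbhs x0 U, Q *m Q^T = 1%:M, [lipschitz g y | y in setT] &
        forall x, U x ->
          (Omega x <-> g (col' j (x *m Q)) < (x *m Q) 0 j)].

Record bounded_lipschitz_domain (R : realType) (n : nat)
    (Omega : set 'rV[R]_n) : Prop := BoundedLipschitzDomain {
  domain_nonempty : Omega !=set0 ;
  domain_open : open Omega ;
  domain_connected : connected Omega ;
  domain_bounded : bounded_set Omega ;
  domain_lipschitz : lipschitz_boundary Omega }.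

(* Stated for normed spaces: completeness of X and W plays no role. *)
Definition newton_derivative (R : realType) (X W : normedModType R)
    (G : X -> W) (DG : X -> {linear X -> W}) : Prop :=
  (forall u, exists M : R, forall v, `|DG u v| <= M * `|v|) /\
  (forall u, (fun v => G (u + v) - G u - DG (u + v) v) =o_ (nbhs (0 : X)) id).

(* Main.v *)
Require Import Defs.
From HB Require Import structures.
From mathcomp Require Import ring lra.
From mathcomp Require Import all_boot all_order all_algebra.
From mathcomp Require Import all_classical all_reals all_analysis.
From mathcomp Require Import measurable_realfun ess_sup_inf.
Import Order.TTheory GRing.Theory Num.Theory.
Import numFieldNormedType.Exports.
Local Open Scope classical_set_scope.
Local Open Scope ring_scope.

(** The remainder max(a, u + v) - max(a, u) - h(u + v) v vanishes at every
    point where u and u + v lie on the same side of a.  At any other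
    point its absolute value is |u - a|, which is at most |v|.  Hence the
    remainder is dominated by 1_E |v| with E = {0 < |u - a| <= |v|}
    ([max_remainder_le]), and Hoelder's inequality with 1/p = 1/s + 1/q
    ([generalized_hoelder]) gives
      ||remainder||_p <= mu(E)^(1/s) ||v||_q    ([max_remainder_norm]).

    Since p < q the exponent s is finite, so it is enough that mu(E) tends to 0
    with ||v||_q ([crossing_small]).  For any delta > 0, E is contained in
    {0 < |u - a| <= delta} together with {|v| >= delta}.  The first set does
    not depend on v, and its measure tends to 0 with delta because these sets
    decrease to the empty set and the measure is finite
    ([measure_gap_small]).  The measure of the second one is controlled by
    Chebyshev's inequality ([chebyshev_Lnorm]).

    Everything up to [max_newton_derivative] holds on an arbitrary finite
    measure space and for a in L^p; the domain enters only because a bounded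
    set has finite Lebesgue measure, which also gives L^r <= L^p for the
    obstacle a. *)

Set Implicit Arguments.
Unset Strict Implicit.
Unset Printing Implicit Defensive.

(** * Monotonicity of the Lp norm and Hoelder's inequality *)

Section Lnorm_complements.
Context d (T : measurableType d) (R : realType).
Variable mu : {measure set T -> \bar R}.
Implicit Types (f g : T -> R) (p q s : \bar R) (E : set T).
Local Open Scope ereal_scope.

Local Notation "'N_ p [ f ]" := (Lnorm mu p (EFin \o f)).

Lemma mem_LfunP p f :
  f \in Lfun mu p <-> measurable_fun setT f /\ 'N_p[f] < +oo.
Proof.
split=> [/andP[]|[mf ffin]]; first by rewrite !inE.
by apply/andP; split; rewrite inE.
Qed.

Lemma measurable_powR_norm (r : R) f : measurable_fun setT f ->
  measurable_fun setT (fun x => `|f x| `^ r)%R.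
Proof.
move=> mf.
apply: (measurableT_comp (measurable_powR (R:=R) r)).
exact: measurableT_comp.
Qed.

Lemma le_Lnorm p f g : measurable_fun setT f -> measurable_fun setT g ->
  1 <= p -> (\forall x \ae mu, `|f x| <= `|g x|)%R ->
  'N_p[f] <= 'N_p[g].
Proof.
move=> mf mg p1 fg; rewrite unlock.
have mpow (h : T -> R) r : measurable_fun setT h ->
    measurable_fun setT (fun x => `|(EFin \o h) x| `^ r).
  move=> mh; apply: (measurableT_comp (measurable_poweR _)).
  by apply: measurableT_comp => //; exact/measurable_EFinP.
case: p p1 => [p p1|_|//].
- have p0 : (0 < p)%R by rewrite (lt_le_trans ltr01).
  apply: gt0_ler_poweR; first by rewrite invr_ge0 ltW.
  + by rewrite in_itv/= leey andbT integral_ge0.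
  + by rewrite in_itv/= leey andbT integral_ge0.
  apply: ae_ge0_le_integral => //.
  + by move=> x _; exact: poweR_ge0.
  + exact: mpow.
  + by move=> x _; exact: poweR_ge0.
  + exact: mpow.
  apply: filterS fg => x fg _.
  by rewrite lee_fin ge0_ler_powR// ?ltW// nnegrE.
- case: ifPn => // _; apply: le_ess_sup.
  by apply: filterS fg => x; rewrite lee_fin.
Qed.

Lemma Lfun_le p f g : 1 <= p -> measurable_fun setT f ->
  (\forall x \ae mu, `|f x| <= `|g x|)%R -> g \in Lfun mu p -> f \in Lfun mu p.
Proof.
move=> p1 mf fg /mem_LfunP[mg gfin]; apply/mem_LfunP; split=> //.
exact: le_lt_trans (le_Lnorm mf mg p1 fg) gfin.
Qed.

Lemma Lnorm_scale p (c : R) f : 1 <= p -> f \in Lfun mu p ->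
  'N_p[(fun x => c * f x)%R] = `|c|%:E * 'N_p[f].
Proof. by move=> p1 fL; exact: (LnormZ (Lfun_Sub p1 fL)). Qed.

Lemma Lnorm_indic (s : R) E : (0 < s)%R -> measurable E ->
  'N_s%:E[\1_E] = mu E `^ s^-1.
Proof.
move=> s0 mE; rewrite unlock; congr (_ `^ _).
rewrite -[in RHS](setIT E) -integral_indic//; apply: eq_integral => x _ /=.
rewrite indicE; case: (x \in E); first by rewrite normr1 powR1.
by rewrite normr0 powR0// gt_eqF.
Qed.

(** Change of exponent, through which Hoelder's inequality for a general p is
    reduced to the case p = 1. *)
Lemma Lnorm_norm_powR (p t : R) f : (0 < p)%R -> (0 < t)%R ->
  'N_t%:E[(fun x => `|f x| `^ p)%R] = 'N_(p * t)%:E[f] `^ p.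
Proof.
move=> p0 t0; rewrite unlock -poweRrM invfM mulrAC mulVf ?gt_eqF// mul1r.
congr (_ `^ _); apply: eq_integral => x _ /=.
by rewrite norm_powR// normr_id -powRrM.
Qed.

(** When the whole space is negligible, the L^oo norm is 0 by convention rather
    than an essential supremum; the bound then holds because every property
    holds almost everywhere. *)
Lemma ae_norm_le_Lnormy f : f \in Lfun mu +oo ->
  (\forall x \ae mu, `|f x| <= fine 'N_+oo[f])%R.
Proof.
move=> /mem_LfunP[mf ffin].
have fE : (fine 'N_+oo[f])%:E = 'N_+oo[f].
  by rewrite fineK// ge0_fin_numE// Lnorm_ge0.
have [mu0|mu0] := ltP 0 (mu setT); last first.
  have /ae_eq0 : mu setT = 0 by apply/eqP; rewrite eq_le mu0 measure_ge0.
  move=> /(_ _ (fun x => f x) (cst 0%R) measurableT).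
  apply: filterS => x /= ->//.
  by rewrite normr0 fine_ge0 ?Lnorm_ge0.
have := ess_sup_ge mu (abse \o (EFin \o f)).
apply: filterS => x /=.
by rewrite -lee_fin fE unlock mu0.
Qed.

(** The endpoint of Hoelder's inequality: multiplication by a function bounded
    almost everywhere by M scales the norm by at most M. *)
Lemma hoeldery p f g : 1 <= p -> f \in Lfun mu p -> g \in Lfun mu +oo ->
  'N_p[(f \* g)%R] <= 'N_p[f] * 'N_+oo[g].
Proof.
move=> p1 fL gL; have [mf _] := (mem_LfunP _ _).1 fL.
have [mg gfin] := (mem_LfunP _ _).1 gL.
set M := fine 'N_+oo[g].
have M0 : (0 <= M)%R by rewrite fine_ge0// Lnorm_ge0.
have ME : M%:E = 'N_+oo[g] by rewrite fineK// ge0_fin_numE// Lnorm_ge0.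
rewrite -ME muleC -[M in leRHS]ger0_norm// -Lnorm_scale//.
apply: le_Lnorm => //; [exact: measurable_funM|exact: measurable_funM|].
have := ae_norm_le_Lnormy gL; apply: filterS => x gx.
by rewrite /= !normrM mulrC (ger0_norm M0) ler_wpM2r.
Qed.

(** For finite exponents this is the usual inequality for conjugate exponents
    s/p and q/p, applied to |f|^p and |g|^p, after taking p-th roots.  If q
    (or s) is infinite, then p = s (or p = q) and it is the endpoint case. *)
Lemma generalized_hoelder p s q f g : 1 <= p -> 1 <= s -> 1 <= q ->
  p^-1 = s^-1 + q^-1 -> f \in Lfun mu s -> g \in Lfun mu q ->
  'N_p[(f \* g)%R] <= 'N_s[f] * 'N_q[g].
Proof.
have ge1_gt0 (x : R) : 1 <= x%:E -> (0 < x)%R.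
  by rewrite lee_fin; exact: lt_le_trans.
move=> p1 s1; case: q => [q||//] q1; last first.
  rewrite invey adde0 => /(can_inj (@inveK _)) ps.
  by rewrite ps in p1 *; exact: hoeldery.
case: s s1 => [s||//] s1; last first.
  rewrite invey add0e => /(can_inj (@inveK _)) pq fL gL; rewrite pq in p1 *.
  rewrite muleC; apply: le_trans (hoeldery _ gL fL) => //.
  by under eq_Lnorm do rewrite /= mulrC.
have s0 := ge1_gt0 _ s1; have q0 := ge1_gt0 _ q1.
case: p p1 => [p||//] p1; last first.
  rewrite invey !inver !gt_eqF// => -[] /eqP.
  by rewrite lt_eqF// addr_gt0// invr_gt0.
have p0 := ge1_gt0 _ p1.
rewrite !inver !gt_eqF// => -[psq] /mem_LfunP[mf _] /mem_LfunP[mg _].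
pose F x := (`|f x| `^ p)%R; pose G x := (`|g x| `^ p)%R.
have /(@hoelder _ _ _ mu F G (s / p) (q / p)) : measurable_fun setT F.
  exact: measurable_powR_norm.
move=> /(_ (measurable_powR_norm _ mg)).
rewrite !divr_gt0// => /(_ isT isT).
rewrite !invf_div -mulrDr -psq divff ?gt_eqF// => /(_ erefl).
rewrite /F /G !Lnorm_norm_powR ?divr_gt0//.
rewrite (_ : (_ \* _)%R = fun x => `|(f \* g)%R x| `^ p)%R; last first.
  by apply/funext => x /=; rewrite normrM powRM.
rewrite Lnorm_norm_powR// mulr1 !(mulrC p) !divfK ?gt_eqF//.
rewrite -poweRM ?Lnorm_ge0// => /(gt0_ler_poweR (r := p^-1)).
rewrite -!poweRrM divff ?gt_eqF// !poweRe1 ?mule_ge0 ?Lnorm_ge0//; apply.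
- by rewrite invr_ge0 ltW.
- by rewrite in_itv/= leey poweR_ge0.
- by rewrite in_itv/= leey poweR_ge0.
Qed.

Lemma Lfun_mul p s q f g : 1 <= p -> 1 <= s -> 1 <= q ->
  p^-1 = s^-1 + q^-1 -> f \in Lfun mu s -> g \in Lfun mu q ->
  (f \* g)%R \in Lfun mu p.
Proof.
move=> p1 s1 q1 psq fL gL; have [mf ffin] := (mem_LfunP _ _).1 fL.
have [mg gfin] := (mem_LfunP _ _).1 gL.
apply/mem_LfunP; split; first exact: measurable_funM.
apply: le_lt_trans (generalized_hoelder p1 s1 q1 psq fL gL) _.
by rewrite lte_mul_pinfty ?Lnorm_ge0// ge0_fin_numE// Lnorm_ge0.
Qed.

End Lnorm_complements.

(** * Multiplication operators from L^q to L^p *)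

Section Lspace_mul.
Context d (T : measurableType d) (R : realType).
Variable mu : {measure set T -> \bar R}.
Variables (p s q : \bar R).
Variables (p1 : (1 <= p)%E) (s1 : (1 <= s)%E) (q1 : (1 <= q)%E).
Hypothesis psq : (p^-1 = s^-1 + q^-1)%E.
Variable g : LspaceType mu s1.
Implicit Types v : LspaceType mu q1.

Definition Lspace_mul v : LspaceType mu p1 :=
  toLspace p1 (Lfun_mul p1 s1 q1 psq (Lspace_Lfun g) (Lspace_Lfun v)).

Lemma Lspace_mulE v : (Lspace_mul v : T -> R) = (fun x => g x * v x) %[ae mu].
Proof. exact: toLspaceE. Qed.

Lemma Lspace_mul_linear : linear Lspace_mul.
Proof.
move=> c v w; apply/Lspace_eqP.
have h1 := Lspace_mulE (c *: v + w).
have h2 := Lspace_addE (c *: v) w; have h3 := Lspace_scaleE c v.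
have h4 := Lspace_addE (c *: Lspace_mul v) (Lspace_mul w).
have h5 := Lspace_scaleE c (Lspace_mul v).
have h6 := Lspace_mulE v; have h7 := Lspace_mulE w.
apply: filterS2 (filterI (filterI h1 h2) (filterI h3 h4))
  (filterI h5 (filterI h6 h7)).
move=> x [[{}h1 {}h2] [{}h3 {}h4]] [{}h5 [{}h6 {}h7]] xT.
by rewrite h1// h2// h3// h4// h5// h6// h7// mulrDr mulrCA.
Qed.

HB.instance Definition _ := GRing.isLinear.Build R (LspaceType mu q1)
  (LspaceType mu p1) _ Lspace_mul Lspace_mul_linear.

Lemma Lspace_mul_bounded v : `|Lspace_mul v| <= `|g| * `|v|.
Proof.
rewrite -lee_fin EFinM !Lspace_normE (Lnorm_ae p1 _ _ (Lspace_mulE v)).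
- exact: (generalized_hoelder p1 s1 q1 psq (Lspace_Lfun g) (Lspace_Lfun v)).
- exact: Lspace_measurable.
- by apply: measurable_funM; exact: Lspace_measurable.
Qed.

End Lspace_mul.

(** * Functions on a finite measure space *)

Section finite_measure_Lfun.
Context d (T : measurableType d) (R : realType).
Variable mu : {measure set T -> \bar R}.
Hypothesis muT : mu setT \is a fin_num.
Implicit Types (f g v w : T -> R) (p s q : \bar R).

Local Notation "'N_ p [ f ]" := (Lnorm mu p (EFin \o f)).

Lemma Lfun_bounded p f (M : R) : (1 <= p)%E -> measurable_fun setT f ->
  (forall x, `|f x| <= M) -> f \in Lfun mu p.
Proof.
move=> p1 mf fM; apply: (Lfun_subset p1 (leey 1%E) muT (leey p)).
apply/(mem_LfunP mu); split=> //; rewrite unlock; case: ifPn => // mu0.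
apply: (@le_lt_trans _ _ M%:E); last by rewrite ltry.
by apply/ess_supP; apply: aeW => x; rewrite lee_fin.
Qed.

(** Writing max(f, g) = f + max(0, g - f) reduces the claim to the stability of
    L^p under sums and domination. *)
Lemma Lfun_maxr p f g : (1 <= p)%E -> f \in Lfun mu p -> g \in Lfun mu p ->
  (fun x => Num.max (f x) (g x)) \in Lfun mu p.
Proof.
move=> p1 fL gL; have [mf _] := (mem_LfunP _ _ _).1 fL.
have [mg _] := (mem_LfunP _ _ _).1 gL.
have [L0 LZ] := Lfun_submod_closed mu p1.
have dL := LZ (-1) _ _ fL gL; have [md _] := (mem_LfunP _ _ _).1 dL.
pose k : T -> R := fun x => Num.max 0 ((-1 *: f + g) x).
have kL : k \in Lfun mu p.
  apply: Lfun_le dL => //; first exact: measurable_maxr.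
  apply: aeW => x; rewrite /k; case: (leP 0 ((-1 *: f + g) x)) => // _.
  by rewrite normr0.
rewrite (_ : (fun x => _) = 1 *: f + k); first exact: LZ.
apply/funext => x; rewrite /k scale1r !fctE/= addr_maxr addr0.
by rewrite scaleN1r addNKr.
Qed.

Lemma measurable_norm_gap w (delta : R) : measurable_fun setT w ->
  measurable [set x | 0 < `|w x| <= delta].
Proof.
move=> mw; rewrite (_ : [set x | _] = (fun x => `|w x|) @^-1` `]0, delta]).
  rewrite -[X in measurable X]setTI.
  by apply: (measurableT_comp (@normr_measurable R setT) mw).
by apply/seteqP; split=> x; rewrite /= in_itv.
Qed.

Lemma measurable_norm_ge v (delta : R) : measurable_fun setT v ->
  measurable [set x | delta <= `|v x|].
Proof.
move=> mv; rewrite (_ : [set x | _] = (fun x => `|v x|) @^-1` `[delta, +oo[).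
  rewrite -[X in measurable X]setTI.
  by apply: (measurableT_comp (@normr_measurable R setT) mv).
by apply/seteqP; split=> x; rewrite /= in_itv/= andbT.
Qed.

(** The sets {0 < |w| <= 1/(k+1)} decrease to the empty set, and continuity
    from above applies because the measure is finite. *)
Lemma measure_gap_small w (e : R) : measurable_fun setT w -> 0 < e ->
  exists2 delta : R, 0 < delta &
    (mu [set x | (0 < `|w x| <= delta)%R] < e%:E)%E.
Proof.
move=> mw e0; pose F k := [set x | 0 < `|w x| <= k.+1%:R^-1].
have mF k : measurable (F k) by exact: measurable_norm_gap.
have F0 : \bigcap_k F k = set0.
  apply/seteqP; split=> // x Fx.
  have /andP[w0 _] := Fx 0%N Logic.I.
  have [k _ /(_ _ (leqnn k)) /= kw] := near_infty_natSinv_lt (PosNum w0).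
  by have /andP[_] := Fx k Logic.I; rewrite leNgt kw.
have Fcvg : mu \o F @ \oo --> mu (\bigcap_k F k).
  apply: nonincreasing_cvg_mu => //.
  - rewrite (le_lt_trans (le_measure mu _ _ (@subsetT _ _))) ?inE//.
    by rewrite -ge0_fin_numE.
  - by rewrite F0.
  - apply/nonincreasing_seqP => k; apply/subsetPset => x /= /andP[w0 wk].
    by apply/andP; split=> //; rewrite (le_trans wk)// lef_pV2 ?posrE// ler_nat.
move: Fcvg; rewrite F0 measure0 => /fine_cvgP[Ffin /cvgrPdist_lt /(_ _ e0)].
move=> /(filterI Ffin) [k _ /(_ _ (leqnn k)) [/= ffk]].
rewrite sub0r normrN => h; exists k.+1%:R^-1; first by rewrite invr_gt0.
by rewrite -(fineK ffk) lte_fin (le_lt_trans (ler_norm _)).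
Qed.

(** Chebyshev's inequality, as the monotonicity of the norm applied to
    delta * 1_{|v| >= delta} <= |v|. *)
Lemma chebyshev_Lnorm (p delta : R) v : 1 <= p -> 0 < delta ->
  measurable_fun setT v ->
  (delta%:E * mu [set x | (delta <= `|v x|)%R] `^ p^-1 <= 'N_p%:E[v])%E.
Proof.
move=> p1 d0 mv; set E := [set x | _].
have mE : measurable E by exact: measurable_norm_ge.
have EL : \1_E \in Lfun mu p%:E.
  apply: (@Lfun_bounded _ _ 1) => // x.
  by rewrite indicE normr_nat lern1 leq_b1.
rewrite -Lnorm_indic//; last exact: lt_le_trans p1.
rewrite -[delta in leLHS](ger0_norm (ltW d0)) -Lnorm_scale//.
apply: le_Lnorm => //; first exact: measurable_funM.
apply: aeW => x; rewrite indicE; case: (boolP (x \in E)) => [|_].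
  by rewrite inE /E /= mulr1 (gtr0_norm d0).
by rewrite mulr0 normr0.
Qed.

End finite_measure_Lfun.

(** * The Newton derivative of the maximum *)

(** If u and u + v are on the same side of a, then the left-hand side is 0;
    otherwise it is the distance from u to a, which is at most the length of
    the step v.  The case u = a contributes nothing, so the strict inequality
    0 < |u - a| can be kept: without it the crossing set would contain
    {u = a}, possibly of positive measure, for every v. *)
Lemma max_remainder_le (R : realFieldType) (a u v : R) :
  `|Num.max a (u + v) - Num.max a u - (if a < u + v then 1 else 0) * v|
  <= (if 0 < `|u - a| <= `|v| then 1 else 0) * `|v|.
Proof.
have [auv|uva] := ltP a (u + v); have [au|ua] := leP a u;
  rewrite ?mul1r ?mul0r ?subr0.
- rewrite (_ : _ - _ - _ = 0); last by ring.
  by rewrite normr0 mulr_ge0//; case: ifP.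
- rewrite (_ : _ - _ - _ = u - a); last by ring.
  have h : `|u - a| <= `|v|.
    by rewrite ltr0_norm ?subr_lt0// ger0_norm; lra.
  by rewrite h normr_gt0 subr_eq0 lt_eqF// mul1r.
- have [->|ua] := eqVneq u a.
    by rewrite subrr normr0 mulr_ge0//; case: ifP.
  have h : `|u - a| <= `|v|.
    by rewrite ger0_norm ?subr_ge0// ler0_norm; lra.
  by rewrite h normr_gt0 subr_eq0 ua mul1r distrC.
- by rewrite subrr normr0 mulr_ge0//; case: ifP.
Qed.

Section max_newton.
Context d (T : measurableType d) (R : realType).
Variable mu : {measure set T -> \bar R}.
Hypothesis muT : mu setT \is a fin_num.
Variables (p s q : \bar R).
Variables (p1 : (1 <= p)%E) (s1 : (1 <= s)%E) (q1 : (1 <= q)%E).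
Hypothesis pq : (p < q)%E.
Hypothesis psq : (p^-1 = s^-1 + q^-1)%E.
Variable a : T -> R.
Hypothesis aL : a \in Lfun mu p.
Local Notation Lp := (LspaceType mu p1).
Local Notation Ls := (LspaceType mu s1).
Local Notation Lq := (LspaceType mu q1).
Implicit Types u v : Lq.

Let ma : measurable_fun setT a := ((mem_LfunP _ _ _).1 aL).1.

Lemma active_Lfun u : (fun x => if a x < u x then 1 else 0) \in Lfun mu s.
Proof.
apply: (@Lfun_bounded _ _ _ _ muT _ _ 1) => // [|x].
  apply: measurable_fun_ifT => //.
  by apply: measurable_fun_ltr => //; exact: Lspace_measurable.
by case: ifP; rewrite ?normr1// normr0.
Qed.

Definition active u : Ls := toLspace s1 (active_Lfun u).

Lemma activeE u :
  (active u : T -> R) = (fun x => if a x < u x then 1 else 0) %[ae mu].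
Proof. exact: toLspaceE. Qed.

Definition max_op u : Lp := toLspace p1
  (Lfun_maxr p1 aL (Lfun_subset p1 q1 muT (ltW pq) (Lspace_Lfun u))).

Lemma max_opE u :
  (max_op u : T -> R) = (fun x => Num.max (a x) (u x)) %[ae mu].
Proof. exact: toLspaceE. Qed.

Definition max_derive u : {linear Lq -> Lp} :=
  @Lspace_mul _ _ _ mu _ _ _ p1 s1 q1 psq (active u).

(** Contains every point at which the remainder is nonzero, and is easier to
    measure than the set of those points because it depends on v only through
    its absolute value. *)
Definition crossing u v : set T := [set x | 0 < `|u x - a x| <= `|v x|].

Lemma measurable_crossing u v : measurable (crossing u v).
Proof.
have mn (f : T -> R) : measurable_fun setT f ->
    measurable_fun setT (fun x => `|f x|).
  by move=> mf; exact: (measurableT_comp (@normr_measurable R setT) mf).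
have mua : measurable_fun setT (fun x => `|u x - a x|).
  by apply: mn; apply: measurable_funB => //; exact: Lspace_measurable.
have mv : measurable_fun setT (fun x => `|v x|).
  by apply: mn; exact: Lspace_measurable.
rewrite (_ : crossing u v = (fun x => 0 < `|u x - a x|) @^-1` [set true] `&`
    (fun x => `|u x - a x| <= `|v x|) @^-1` [set true]).
  apply: measurableI; rewrite -[X in measurable X]setTI.
    exact: (measurable_fun_ltr (measurable_cst _) mua).
  exact: (measurable_fun_ler mua mv).
by apply/seteqP; split=> x /andP.
Qed.

(** Hoelder's inequality for the pointwise bound.  The norm of the indicator
    tends to 0 with v, which makes the remainder o(|v|) instead of only
    O(|v|). *)
Lemma max_remainder_norm u v :
  (`|max_op (u + v) - max_op u - max_derive (u + v) v|%:E <=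
  'N[mu]_s[EFin \o \1_(crossing u v)] * `|v|%:E)%E.
Proof.
have mE := measurable_crossing u v.
have EL : \1_(crossing u v) \in Lfun mu s.
  apply: (@Lfun_bounded _ _ _ _ muT _ _ 1) => // x.
  by rewrite indicE normr_nat lern1 leq_b1.
rewrite !Lspace_normE.
apply: le_trans (generalized_hoelder p1 s1 q1 psq EL (Lspace_Lfun v)).
apply: le_Lnorm => //.
- exact: Lspace_measurable.
- by apply: measurable_funM => //; exact: Lspace_measurable.
have h1 := Lspace_addE (max_op (u + v) - max_op u) (- max_derive (u + v) v).
have h2 := Lspace_oppE (max_derive (u + v) v).
have h3 := Lspace_addE (max_op (u + v)) (- max_op u).
have h4 := Lspace_oppE (max_op u).
have h5 := max_opE (u + v); have h6 := max_opE u.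
have h7 := Lspace_mulE p1 psq (active (u + v)) v.
have h8 := activeE (u + v); have h9 := Lspace_addE u v.
apply: filterS3 (filterI (filterI h1 h2) h3) (filterI (filterI h4 h5) h6)
  (filterI (filterI h7 h8) h9).
move=> x [[{}h1 {}h2] {}h3] [[{}h4 {}h5] {}h6] [[{}h7 {}h8] {}h9].
rewrite h1// h2// h3// h4// h5// h6// h7// h8// h9//.
rewrite [leRHS]normrM indicE.
apply: le_trans (max_remainder_le _ _ _) _.
rewrite ler_wpM2r//; case: ifP => // h.
by rewrite mem_set// normr1.
Qed.

(** The norm is mu(E)^(1/s), with E the crossing set, so the target for mu(E)
    is e^s.  Fixing first delta so that {0 < |u - a| <= delta} takes at most
    half of it, Chebyshev's inequality in L^p and ||v||_p <= ||1||_s ||v||_q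
    tell how small v must be for {|v| >= delta} to take at most the other
    half. *)
Lemma crossing_small u (e : R) : 0 < e ->
  exists2 rho : R, 0 < rho &
    forall v, `|v| < rho -> ('N[mu]_s[EFin \o \1_(crossing u v)] <= e%:E)%E.
Proof.
move=> e0.
(* An infinite s would force p = q. *)
have sfin : s \is a fin_num.
  rewrite ge0_fin_numE ?(le_trans _ s1)// ltNge leye_eq; apply/eqP => soo.
  move: psq pq; rewrite soo invey add0e.
  by move=> /(can_inj (@inveK _)) ->; rewrite ltxx.
have pfin : p \is a fin_num.
  by rewrite ge0_fin_numE ?(le_trans _ p1)// (lt_le_trans pq) ?leey.
rewrite -(fineK sfin); set s' := fine s; set p' := fine p.
have s'1 : 1 <= s' by rewrite -lee_fin fineK.
have p'1 : 1 <= p' by rewrite -lee_fin fineK.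
have s'0 : 0 < s' by exact: lt_le_trans s'1.
have p'0 : 0 < p' by exact: lt_le_trans p'1.
pose b := e `^ s' / 2.
have b0 : 0 < b by rewrite divr_gt0// powR_gt0.
have mua : measurable_fun setT (fun x => u x - a x).
  by apply: measurable_funB => //; exact: Lspace_measurable.
have [delta delta0 gap] := measure_gap_small muT mua b0.
have oneL : cst 1 \in Lfun mu s.
  by apply: (@Lfun_bounded _ _ _ _ muT _ _ 1) => // x; rewrite normr1.
have [_ onefin] := (mem_LfunP _ _ _).1 oneL.
set C := fine 'N[mu]_s[EFin \o cst 1].
have C0 : 0 <= C by rewrite fine_ge0// Lnorm_ge0.
have CE : C%:E = (Lnorm mu s (EFin \o cst 1%R))%E.
  by rewrite fineK// ge0_fin_numE// Lnorm_ge0.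
(* C may be 0, on a negligible space, hence the division by C + 1 below. *)
have C1 : 0 < C + 1 by rewrite ltr_wpDl.
pose rho := delta * b `^ p'^-1 / (C + 1).
exists rho => [|v vrho]; first by rewrite !(divr_gt0, mulr_gt0)// powR_gt0.
pose big := [set x | delta <= `|v x|].
have mbig : measurable big by exact/measurable_norm_ge/Lspace_measurable.
have mbig_le : (mu big <= b%:E)%E.
  have muE : mu big = (fine (mu big))%:E.
    rewrite fineK// ge0_fin_numE//.
    rewrite (le_lt_trans (le_measure mu _ _ (@subsetT _ _))) ?inE//.
    by rewrite -ge0_fin_numE.
  have := chebyshev_Lnorm muT p'1 delta0 (Lspace_measurable v).
  rewrite -/big /p' fineK// => cheb.
  have := generalized_hoelder p1 s1 q1 psq oneL (Lspace_Lfun v).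
  rewrite (_ : (cst 1 \* v) = v :> (T -> R)); last first.
    by apply/funext => x /=; rewrite mul1r.
  rewrite -CE -Lspace_normE -EFinM => /(le_trans cheb).
  rewrite muE poweR_EFin -EFinM !lee_fin => h.
  rewrite leNgt; apply/negP => bm.
  have : delta * b `^ (fine p)^-1 < delta * (fine (mu big)) `^ (fine p)^-1.
    rewrite ltr_pM2l// gt0_ltr_powR ?invr_gt0// nnegrE ltW//.
    exact: lt_trans bm.
  rewrite ltNge => /negP; apply; apply: le_trans h _.
  rewrite (@le_trans _ _ ((C + 1) * rho))//; last first.
    by rewrite mulrC divfK// gt_eqF.
  by apply: ler_pM => //; [exact: (normr_ge0 v)|rewrite lerDl|exact: ltW].
have sub : crossing u v `<=` [set x | 0 < `|u x - a x| <= delta] `|` big.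
  move=> x /andP[gap0 le_v]; have [vd|vd] := leP delta `|v x|; first by right.
  by left; rewrite /= gap0 (le_trans le_v)// ltW.
have mgap : measurable [set x | 0 < `|u x - a x| <= delta].
  exact: measurable_norm_gap.
have mcross : (mu (crossing u v) <= (e `^ s')%:E)%E.
  rewrite (le_trans (le_measure mu _ _ sub)) ?inE//.
  - exact: measurable_crossing.
  - exact: measurableU.
  rewrite (le_trans (measureU2 _ _ _))// [e `^ s']splitr EFinD leeD//.
  exact: ltW.
have -> := Lnorm_indic mu s'0 (measurable_crossing u v).
rewrite (@le_trans _ _ ((e `^ s')%:E `^ s'^-1)%E)//.
  apply: gt0_ler_poweR => //; first by rewrite invr_ge0 ltW.
  - by rewrite in_itv/= leey measure_ge0.
  - by rewrite in_itv/= leey lee_fin powR_ge0.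
by rewrite poweR_EFin -powRrM divff ?gt_eqF// powRr1// ltW.
Qed.

Theorem max_newton_derivative : newton_derivative max_op max_derive.
Proof.
split=> [u|u]; first by exists `|active u| => v; exact: Lspace_mul_bounded.
apply/eqoP => e e0.
have [rho rho0 small] := crossing_small u e0.
apply: filterS (nbhs0_lt rho0) => v vrho.
rewrite -lee_fin EFinM.
apply: le_trans (max_remainder_norm u v) _.
by rewrite lee_wpmul2r ?lee_fin// small.
Qed.

End max_newton.

(** * Bounded sets have finite Lebesgue measure *)

Lemma normr_coord_le (R : realType) (n : nat) (x : 'rV[R]_n) i :
  `|x 0 i| <= `|x|.
Proof.
rewrite (_ : `|x| = mx_norm x)// mx_normrE; apply/bigmax_geP; right.
by exists (0, i).
Qed.

(** A bounded set is contained in a cube, whose measure is known. *)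
Lemma lebesgue_Rn_bounded (R : realType) (n : nat) (A : set 'rV[R]_n) :
  bounded_set A -> measurable (A : set (borelRn R n)) ->
  (lebesgue_Rn R n A < +oo)%E.
Proof.
move=> [M [Mreal AM]] mA; pose c : R := `|M| + 1.
have c0 : 0 <= c by rewrite addr_ge0.
pose lo : 'rV[R]_n := const_mx (- c); pose hi : 'rV[R]_n := const_mx c.
pose B := [set x : 'rV[R]_n | forall i, lo 0 i <= x 0 i <= hi 0 i].
have mB : measurable (B : set (borelRn R n)).
  rewrite (_ : B = \bigcap_(i in [set: 'I_n])
      ((fun x : borelRn R n => (x : 'rV[R]_n) 0 i) @^-1` `[- c, c])).
    apply: fin_bigcap_measurable; first by apply: finite_finset.
    by move=> i _; rewrite -[X in measurable X]setTI; exact: measurable_coord.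
  apply/seteqP; split => x /= h i.
    by move=> _; have := h i; rewrite !mxE /= in_itv.
  by have := h i Logic.I; rewrite /= in_itv !mxE.
have AB : A `<=` B.
  move=> x Ax i; rewrite !mxE -ler_norml (le_trans (normr_coord_le _ _))//.
  by apply: AM Ax; rewrite (le_lt_trans (ler_norm M))// ltrDl.
have Bfin : (lebesgue_Rn R n B < +oo)%E.
  by rewrite lebesgue_Rn_box ?ltry// => i; rewrite !mxE ge0_cp.
by apply: le_lt_trans Bfin; apply: le_measure; rewrite ?inE.
Qed.

(** * The maximum on a bounded Lipschitz domain *)

Theorem lemma3p5 (R : realType) (n : nat) (hn : (1 <= n <= 3)%N)
    (Omega : set 'rV[R]_n) (hOmega : bounded_lipschitz_domain Omega)
    (p r q s : \bar R)
    (p1 : (1 <= p)%E) (r1 : (1 <= r)%E) (q1 : (1 <= q)%E) (s1 : (1 <= s)%E)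
    (hpr : (p <= r)%E) (hrq : (r < q)%E) (hs : (p^-1 = s^-1 + q^-1)%E)
    (a : LspaceType (lebesgue_on (domain_open hOmega)) r1) :
  let mu := lebesgue_on (domain_open hOmega) in
  exists (m : LspaceType mu q1 -> LspaceType mu p1)
         (h : LspaceType mu q1 -> LspaceType mu s1)
         (Dm : LspaceType mu q1 ->
               {linear LspaceType mu q1 -> LspaceType mu p1}),
    [/\ forall u, (m u : _ -> R) = (fun x => Num.max (a x : R) (u x)) %[ae mu],
        forall u, (h u : _ -> R) =
                  (fun x => if (a x : R) < u x then 1 else 0) %[ae mu],
        forall u v, (Dm u v : _ -> R) = (fun x => (h u x : R) * v x) %[ae mu] &
        newton_derivative m Dm].
Proof.
move=> mu.
have muT : mu setT \is a fin_num.
  rewrite ge0_fin_numE//.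
  rewrite (_ : mu setT = lebesgue_Rn R n (setT `&` Omega))// setTI.
  apply: lebesgue_Rn_bounded; first exact: (domain_bounded hOmega).
  exact: open_borelRn (domain_open hOmega).
have pq : (p < q)%E by exact: le_lt_trans hrq.
have aL : (a : _ -> R) \in Lfun mu p.
  exact: (Lfun_subset p1 r1 muT hpr (Lspace_Lfun a)).
exists (max_op muT p1 (q1 := q1) pq aL), (active muT s1 (q1 := q1) aL),
  (max_derive muT p1 s1 (q1 := q1) hs aL).
split.
- exact: max_opE.
- exact: activeE.
- by move=> u v; exact: Lspace_mulE.
- exact: max_newton_derivative.
Qed.
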